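(* For integers $N\ge 1$ and $n\ge 1$, $$B_{N,n}=n!\sum_{k=1}^n\binom{n+1}{k+1}\frac{(-N!)^k\,k!}{(n+Nk)!}\begin{Bmatrix}n+Nk\\ k\end{Bmatrix}_{\ge N}.$$
   Context: The hypergeometric Bernoulli numbers $B_{N,n}$ are defined by $\frac{1}{{}_1F_1(1;N+1;x)}=\sum_{n=0}^\infty B_{N,n}\frac{x^n}{n!}$, where ${}_1F_1(a;b;z)=\sum_{n=0}^\infty\frac{(a)^{(n)}}{(b)^{(n)}}\frac{z^n}{n!}$ with $(a)^{(n)}=a(a+1)\cdots(a+n-1)$, $(a)^{(0)}=1$. For $m\ge 1$, the associated Stirling numbers of the second kind $\begin{Bmatrix}n\\ k\end{Bmatrix}_{\ge m}$ are defined by $\frac{(e^x-E_{m-1}(x))^k}{k!}=\sum_{n=0}^\infty\begin{Bmatrix}n\\ k\end{Bmatrix}_{\ge m}\frac{x^n}{n!}$, where $E_m(x)=\sum_{j=0}^m\frac{x^j}{j!}$. *)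

(* Defs.v *)
From mathcomp Require Import all_boot all_order all_algebra.

Set Implicit Arguments.
Unset Strict Implicit.
Unset Printing Implicit Defensive.

Import Order.TTheory GRing.Theory Num.Theory.
Local Open Scope ring_scope.

(* A formal power series over the rationals is identified with its sequence
   of ordinary coefficients: f n is the coefficient of x^n. *)
Definition fps := nat -> rat.

Definition fps_one : fps := fun n => (n == 0)%:R.
Definition fps_sub (f g : fps) : fps := fun n => f n - g n.
Definition fps_scale (c : rat) (f : fps) : fps := fun n => c * f n.
Definition fps_mul (f g : fps) : fps :=
  fun n => \sum_(i < n.+1) f i * g (n - i)%N.
Definition fps_exp (f : fps) (k : nat) : fps := iter k (fps_mul f) fps_one.
Definition fps_of_poly (p : {poly rat}) : fps := fun n => p`_n.

(* fps_inv_prefix f n lists the coefficients of orders 0, ..., n of 1 / f.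
   When f 0 = 0 there is no inverse and the value is meaningless. *)
Fixpoint fps_inv_prefix (f : fps) (n : nat) : seq rat :=
  if n is m.+1 then
    let s := fps_inv_prefix f m in
    rcons s (- (f 0%N)^-1 * \sum_(i < m.+1) s`_i * f (m.+1 - i)%N)
  else [:: (f 0%N)^-1].
Definition fps_inv (f : fps) : fps := fun n => (fps_inv_prefix f n)`_n.

Lemma size_fps_inv_prefix f n : size (fps_inv_prefix f n) = n.+1.
Proof. by elim: n => //= n IHn; rewrite size_rcons IHn. Qed.

Lemma nth_fps_inv_prefix f n i :
  (i <= n)%N -> (fps_inv_prefix f n)`_i = fps_inv f i.
Proof.
elim: n => [|n IHn]; first by rewrite leqn0 => /eqP->.
rewrite leq_eqVlt => /predU1P[-> //|lt_in] /=.
by rewrite nth_rcons size_fps_inv_prefix lt_in IHn.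
Qed.

Lemma fps_mulVf (f : fps) : f 0%N != 0 -> fps_mul (fps_inv f) f =1 fps_one.
Proof.
move=> f0 [|n]; first by rewrite /fps_mul big_ord1 /= mulVf.
rewrite /fps_mul big_ord_recr /= subnn.
rewrite {2}/fps_inv /= nth_rcons size_fps_inv_prefix ltnn eqxx.
rewrite mulrAC mulNr mulVf // mulN1r.
apply/eqP; rewrite subr_eq0; apply/eqP/eq_bigr => i _.
by rewrite nth_fps_inv_prefix // -ltnS.
Qed.

Lemma fps_inv_unique (f g : fps) :
  f 0%N != 0 -> fps_mul g f =1 fps_one -> g =1 fps_inv f.
Proof.
move=> f0 gf n; have [m] := ubnP n; elim: m n => // m IHm n ltnm.
have : fps_mul g f n = fps_mul (fps_inv f) f n by rewrite gf fps_mulVf.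
rewrite /fps_mul !big_ord_recr /= subnn => /eqP.
under eq_bigr => i _.
  rewrite IHm; last by rewrite (leq_trans (ltn_ord i)) // -ltnS.
  over.
by rewrite (inj_eq (addrI _)) (inj_eq (mulIf f0)) => /eqP.
Qed.

(* The sequence a such that f = sum_n a_n x^n / n!. *)
Definition egf_coef (f : fps) (n : nat) : rat := n`!%:R * f n.

Definition rising (a : rat) (n : nat) : rat := \prod_(i < n) (a + i%:R).

Definition hyp1F1 (a b : rat) : fps :=
  fun n => rising a n / rising b n * (n`!%:R)^-1.

Definition hyp_bernoulli (N n : nat) : rat :=
  egf_coef (fps_inv (hyp1F1 1 (N.+1)%:R)) n.

Lemma hyp_bernoulli_gen (N : nat) :
  fps_mul (fun n => hyp_bernoulli N n / n`!%:R) (hyp1F1 1 (N.+1)%:R)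
    =1 fps_one.
Proof.
move=> n; rewrite -(@fps_mulVf (hyp1F1 1 (N.+1)%:R)).
  apply: eq_bigr => i _; congr (_ * _); rewrite /hyp_bernoulli /egf_coef mulrC.
  by rewrite mulKf // pnatr_eq0 -lt0n fact_gt0.
by rewrite /hyp1F1 /rising !big_ord0 !divr1 oner_neq0.
Qed.

Definition fps_expx : fps := fun n => (n`!%:R)^-1.

Definition exp_trunc (m : nat) : {poly rat} :=
  \sum_(j < m.+1) (j`!%:R)^-1 *: 'X^j.

(* Meaningful for 1 <= m only: for m = 0 the truncated predecessor makes it
   coincide with the case m = 1. *)
Definition stirling2_ge (m n k : nat) : rat :=
  egf_coef
    (fps_scale (k`!%:R)^-1
       (fps_exp (fps_sub fps_expx (fps_of_poly (exp_trunc m.-1))) k)) n.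

(* Main.v *)
(** Put F = 1F1(1;N+1;x), so that F = N! (e^x - E_{N-1}(x)) / x^N, and the right
    hand side is n! [x^n] sum_{k=1}^n C(n+1,k+1) (-F)^k. Since F has constant
    coefficient 1, (1 - F)^(n+1) = O(x^(n+1)); expanding and dividing by F
    gives 1/F = sum_{k=0}^n C(n+1,k+1) (-F)^k + O(x^(n+1)), where the term
    k = 0 does not contribute to [x^n] as n > 0. *)
Require Import Defs.
From mathcomp Require Import all_boot all_order all_algebra.

Set Implicit Arguments.
Unset Strict Implicit.
Unset Printing Implicit Defensive.

Import Order.TTheory GRing.Theory Num.Theory.
Local Open Scope ring_scope.

(** Truncations live in the ring [{poly rat}], where binomial expansion and the factor theorem are
    available. Coefficients of order at most [m] of products and powers involve no higher orders, so
    truncation leaves them intact. *)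
Definition fps_trunc (m : nat) (f : fps) : {poly rat} := \poly_(i < m.+1) f i.

Lemma coef_fps_trunc m f i : (i <= m)%N -> (fps_trunc m f)`_i = f i.
Proof. by move=> le_im; rewrite coef_poly ltnS le_im. Qed.

Lemma coef_fps_truncM m f g i :
  (i <= m)%N -> (fps_trunc m f * fps_trunc m g)`_i = fps_mul f g i.
Proof.
move=> le_im; rewrite coefM; apply: eq_bigr => j _.
have le_ji : (j <= i)%N by rewrite -ltnS.
by rewrite !coef_fps_trunc ?(leq_trans (leq_subr _ _)) ?(leq_trans le_ji).
Qed.

Lemma coef_fps_truncX m f k i :
  (i <= m)%N -> (fps_trunc m f ^+ k)`_i = fps_exp f k i.
Proof.
elim: k i => [|k IHk] i le_im; first by rewrite expr0 coef1.
rewrite exprS coefM; apply: eq_bigr => j _.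
have le_ji : (j <= i)%N by rewrite -ltnS.
rewrite coef_fps_trunc ?(leq_trans le_ji) // IHk //.
exact: leq_trans (leq_subr _ _) le_im.
Qed.

(** The hypotheses amount to f = c x^N g, hence f^k = c^k x^(Nk) g^k. *)
Lemma fps_exp_shift (f g : fps) (c : rat) (N n k : nat) :
    (forall i, (i < N)%N -> f i = 0) -> (forall i, f (N + i)%N = c * g i) ->
  fps_exp f k (n + N * k)%N = c ^+ k * fps_exp g k n.
Proof.
move=> f_lt f_ge; set m := (n + N * k)%N.
(* Cutting [f] at order [N + m] matches cutting [g] at [m], which makes this an exact identity of
   polynomials. *)
have trE : fps_trunc (N + m) f = c *: ('X^N * fps_trunc m g).
  apply/polyP=> i; rewrite coefZ coefXnM !coef_poly.
  case: (ltnP i N) => [lt_iN | le_Ni]; first by rewrite f_lt // mulr0 if_same.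
  rewrite -{1 2}(subnKC le_Ni) -(addnS N m) ltn_add2l f_ge.
  by case: ifP; rewrite // mulr0.
rewrite -(@coef_fps_truncX (N + m)) ?leq_addl // trE exprZn coefZ exprMn.
rewrite -exprM coefXnM ltnNge leq_addl /= addnK coef_fps_truncX //.
exact: leq_addr.
Qed.

Lemma fps_inv_binomial (f : fps) (n : nat) : f 0%N = 1 ->
  fps_inv f n =
  \sum_(k < n.+1) 'C(n.+1, k.+1)%:R * (-1) ^+ k * fps_exp f k n.
Proof.
move=> f0; set P := fps_trunc n f; set G := fps_trunc n (fps_inv f).
have GP i : (i <= n)%N -> (G * P)`_i = (i == 0)%:R.
  by move=> le_in; rewrite coef_fps_truncM // fps_mulVf // f0 oner_neq0.
(* [G * P] is 1 only modulo X^(n+1), which is enough to cancel it inside a coefficient of order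
   [n]. *)
have GPM (q : {poly rat}) : (G * P * q)`_n = q`_n.
  rewrite coefM big_ord_recl GP // mul1r subn0 big1 ?addr0 // => i _.
  by rewrite GP //= mul0r.
have : (G * (1 - P) ^+ n.+1)`_n = 0.
  (* The root 0 makes X divide [1 - P], so X^(n+1) divides its power. *)
  have /factor_theorem[Q ->] : root (1 - P) 0.
    by rewrite rootE horner_coef0 coefB coef1 coef_fps_trunc // f0 subrr.
  by rewrite subr0 exprMn mulrA coefMXn leqnn.
(* The term of index 0 is [G] itself; each later one, of index [k.+1], has a factor [P] that cancels
   [G] and leaves [P ^+ k]. *)
rewrite exprBn big_ord_recl expr0 !expr1n bin0 !mulr1 mulrDr coefD mulr1.
rewrite coef_fps_trunc // mulr_sumr coef_sum => /eqP; rewrite addr_eq0 => /eqP->.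
rewrite -sumrN; apply: eq_bigr => k _.
rewrite expr1n mulr1 lift0 mulrnAr coefMn [(-1) ^+ _ * _]mulrC exprS.
rewrite !mulrA -[(G * P) * _ * _]mulrA GPM.
(* As a constant polynomial, the sign can be pulled out of the coefficient. *)
have ->: (-1) ^+ k.+1 = ((-1) ^+ k.+1)%:P :> {poly rat}.
  by rewrite rmorphXn rmorphN rmorph1.
rewrite coefMC coef_fps_truncX // exprS mulN1r mulrN mulNrn opprK.
by rewrite -[LHS]mulr_natl [fps_exp _ _ _ * _]mulrC mulrA.
Qed.

Lemma rising_fact (N n : nat) :
  rising N.+1%:R n = (N + n)`!%:R / N`!%:R :> rat.
Proof.
have N0 : N`!%:R != 0 :> rat by rewrite pnatr_eq0 -lt0n fact_gt0.
elim: n => [|n IHn]; first by rewrite /rising big_ord0 addn0 divff.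
rewrite /rising big_ord_recr /= -/(rising _ _) IHn -natrD addnS factS natrM.
by rewrite addSn mulrC mulrA.
Qed.

Lemma hyp1F1E (N n : nat) :
  hyp1F1 1 N.+1%:R n = N`!%:R / (N + n)`!%:R.
Proof.
(* The instance [N = 0] turns the numerator [rising 1 n] into n!, which cancels 1/n!. *)
rewrite /hyp1F1 rising_fact (rising_fact 0) add0n divr1 invf_div mulrAC.
by rewrite divff ?mul1r // pnatr_eq0 -lt0n fact_gt0.
Qed.

Lemma fps_exp_tailE (N i : nat) : (0 < N)%N ->
  fps_sub fps_expx (fps_of_poly (exp_trunc N.-1)) i =
  if (i < N)%N then 0 else (i`!%:R)^-1.
Proof.
case: N => // N _; rewrite /fps_sub /fps_of_poly /exp_trunc /fps_expx /=.
rewrite -(poly_def _ (fun j => (j`!%:R)^-1)) coef_poly.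
by case: ifP; rewrite ?subrr ?subr0.
Qed.

Lemma stirling2_geE (N n k : nat) : (0 < N)%N ->
  stirling2_ge N (n + N * k) k =
  (n + N * k)`!%:R / (k`!%:R * N`!%:R ^+ k) * fps_exp (hyp1F1 1 N.+1%:R) k n.
Proof.
move=> N_gt0; rewrite /stirling2_ge /egf_coef /fps_scale.
(* The constant 1/N! comes from e^x - E_{N-1}(x) = x^N F / N!. *)
rewrite (@fps_exp_shift _ (hyp1F1 1 N.+1%:R) (N`!%:R)^-1) => [|i lt_iN|i].
- by rewrite invfM exprVn !mulrA.
- by rewrite fps_exp_tailE // lt_iN.
rewrite fps_exp_tailE // ltnNge leq_addr /= hyp1F1E mulKf //.
by rewrite pnatr_eq0 -lt0n fact_gt0.
Qed.

Theorem theorem6 (N n : nat) (hN : (1 <= N)%N) (hn : (1 <= n)%N) :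
  hyp_bernoulli N n =
  n`!%:R * \sum_(1 <= k < n.+1)
    'C(n.+1, k.+1)%:R * ((- N`!%:R) ^+ k * k`!%:R / (n + N * k)%N`!%:R)
      * stirling2_ge N (n + N * k)%N k.
Proof.
have fact_neq0 m : m`!%:R != 0 :> rat by rewrite pnatr_eq0 -lt0n fact_gt0.
rewrite /hyp_bernoulli /egf_coef fps_inv_binomial; last first.
  by rewrite hyp1F1E addn0 divff.
congr (_ * _); rewrite big_ord_recl [fps_exp _ ord0 _]/= /fps_one.
rewrite (gtn_eqF hn) mulr0 add0r big_add1 big_mkord; apply: eq_bigr => i _.
rewrite lift0 stirling2_geE // [RHS]mulrA; congr (_ * _).
rewrite -[RHS]mulrA; congr (_ * _).
(* All factorials cancel, and (-N!)^k against N!^k leaves the sign (-1)^k. *)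
rewrite [RHS]mulrA divfK // [(- N`!%:R) ^+ _]exprNn invfM mulrA mulfK // mulfK //.
by rewrite expf_neq0.
Qed.
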